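(* Let $(N,\langle\,,\,\rangle)$ be a simply connected 2-step nilpotent Lie group with a left-invariant metric and Lie algebra $\mathfrak n=\mathfrak v\oplus\mathfrak z$, let $q\in\mathbb R\setminus\{0\}$, and let $\lambda=\exp(W_1+Z_1)$ be an element of $N$, with $W_1\in\mathfrak v$, $Z_1\in\mathfrak z$. If a left-invariant Lorentz force $F$ of type II admits a $\lambda$-periodic magnetic trajectory, then $W_1\in\ker F$.
   Context: All Lie groups and Lie algebras are real. A Lie algebra $\mathfrak n$ is 2-step nilpotent if $[[U,V],W]=0$ for all $U,V,W\in\mathfrak n$. The left-invariant metric is identified with an inner product on $\mathfrak n$; $\mathfrak z$ is the center of $\mathfrak n$ and $\mathfrak v=\mathfrak z^\perp$. $\exp:\mathfrak n\to N$ is the exponential map. A left-invariant Lorentz force is a left-invariant skew-symmetric $(1,1)$-tensor $F$ on $N$ (equivalently a skew-symmetric map $F:\mathfrak n\to\mathfrak n$) such that the 2-form $\omega_F(U,V)=\langle FU,V\rangle$ on $N$ is closed. $F$ is of type II if $F(\mathfrak v)\subseteq\mathfrak z$ and $F(\mathfrak z)\subseteq\mathfrak v$. A magnetic trajectory for $F$ (with the fixed charge $q$) is a curve $\sigma$ with $\nabla_{\sigma'}\sigma'=qF\sigma'$, $\nabla$ the Levi-Civita connection. For $\lambda\in N$ different from the identity, a curve $\sigma(t)$ is called $\lambda$-periodic with period $\omega$ if $\omega\neq0$ and $\lambda\sigma(t)=\sigma(t+\omega)$ for all $t\in\mathbb R$; it is called $\lambda$-periodic if this holds for some $\omega$. 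*)

(* Defs.v *)
From HB Require Import structures.
From mathcomp Require Import all_boot all_order all_algebra.
From mathcomp Require Import all_classical all_reals all_analysis.

Set Implicit Arguments.
Unset Strict Implicit.
Unset Printing Implicit Defensive.

Import Order.TTheory GRing.Theory Num.Theory numFieldNormedType.Exports.

Local Open Scope classical_set_scope.
Local Open Scope ring_scope.

(* A group with a topology; the compatibility of the two is part of
   [lie_group] below. *)
#[short(type="groupTopologicalType")]
HB.structure Definition GroupTopological :=
  { G of Group G & Topological G }.

Section Smooth.
Context {R : realType}.

(* Only used for open sets A, on which it is the class C^k of maps between
   finite-dimensional spaces. *)
Fixpoint Ck {V W : normedModType R} (k : nat) (A : set V) (f : V -> W) : Prop :=
  match k with
  | 0 => forall x, A x -> {for x, continuous f}
  | k'.+1 => (forall x, A x -> differentiable f x) /\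
             (forall v : V, Ck k' A (fun x => 'D_v f x))
  end.

Definition smooth {V W : normedModType R} (A : set V) (f : V -> W) : Prop :=
  forall k, Ck k A f.

(* [chart_map] and [chart_inv] are total functions whose values are irrelevant
   outside [chart_dom] and outside its image, respectively. *)
Record chart (N : topologicalType) (m : nat) := Chart {
  chart_dom : set N;
  chart_map :> N -> 'rV[R]_m;
  chart_inv : 'rV[R]_m -> N;
  chart_dom_open : open chart_dom;
  chart_img_open : open (chart_map @` chart_dom);
  chart_mapK : forall x, chart_dom x -> chart_inv (chart_map x) = x;
  chart_map_continuous : forall x, chart_dom x -> {for x, continuous chart_map};
  chart_inv_continuous : forall y, (chart_map @` chart_dom) y ->
    {for y, continuous chart_inv}
}.

Definition chart_img (N : topologicalType) m (c : chart N m) : set 'rV[R]_m :=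
  c @` chart_dom c.

Record smooth_atlas (N : topologicalType) m (A : set (chart N m)) : Prop := {
  atlas_cover : forall x, exists2 c, A c & chart_dom c x;
  atlas_compatible : forall c d, A c -> A d ->
    smooth (c @` (chart_dom c `&` chart_dom d))
           (fun y => d (chart_inv c y))
}.

Record lie_group (N : groupTopologicalType) m (A : set (chart N m)) : Prop := {
  lie_group_hausdorff : hausdorff_space N;
  lie_group_second_countable : @second_countable N;
  lie_group_atlas : smooth_atlas A;
  lie_group_mul_continuous : continuous (fun p : N * N => (p.1 * p.2)%g);
  lie_group_inv_continuous : continuous (fun x : N => (x^-1)%g);
  lie_group_mul_smooth : forall c1 c2 c3, A c1 -> A c2 -> A c3 ->
    smooth [set p : 'rV[R]_m * 'rV[R]_m |
              [/\ chart_img c1 p.1, chart_img c2 p.2 &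
                  chart_dom c3 (chart_inv c1 p.1 * chart_inv c2 p.2)%g]]
           (fun p => c3 (chart_inv c1 p.1 * chart_inv c2 p.2)%g);
  lie_group_inv_smooth : forall c d, A c -> A d ->
    smooth [set y | chart_img c y /\ chart_dom d (chart_inv c y)^-1%g]
           (fun y => d (chart_inv c y)^-1%g)
}.

Definition path_connected (T : topologicalType) : Prop :=
  forall x y : T, exists gamma : R -> T,
    [/\ {within `[0, 1], continuous gamma}, gamma 0 = x & gamma 1 = y].

Definition null_homotopic (T : topologicalType) (gamma : R -> T) : Prop :=
  exists H : R * R -> T,
    [/\ {within `[0, 1] `*` `[0, 1], continuous H},
        forall t, t \in `[0, 1] -> H (t, 0) = gamma t,
        forall t, t \in `[0, 1] -> H (t, 1) = gamma 0 &
        forall s, s \in `[0, 1] -> H (0, s) = gamma 0 /\ H (1, s) = gamma 0].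

Definition simply_connected (T : topologicalType) : Prop :=
  path_connected T /\
  forall gamma : R -> T, {within `[0, 1], continuous gamma} ->
    gamma 0 = gamma 1 -> null_homotopic gamma.

End Smooth.

(* The Lie algebra is the tangent space at the identity, identified with
   'rV[R]_m through a chart [phi] whose domain contains the identity.  A tangent
   vector X corresponds to the left-invariant field with value X at 1. *)
Section LieAlgebra.
Context {R : realType} {N : groupTopologicalType} {m : nat}.
Variable phi : @chart R N m.
Local Notation n := 'rV[R]_m.

(* The field x |-> d(L_x) X, in the coordinates [phi]. *)
Definition left_invariant_field (X : n) : n -> n := fun x =>
  'D_X (fun y => phi (chart_inv phi x * chart_inv phi y)%g) (phi 1%g).

(* [U, V]^i = \sum_j (U^j d_j V^i - V^j d_j U^i). *)
Definition field_bracket (U V : n -> n) : n -> n := fun x =>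
  'D_(U x) V x - 'D_(V x) U x.

Definition lie_bracket (X Y : n) : n :=
  field_bracket (left_invariant_field X) (left_invariant_field Y) (phi 1%g).

Definition two_step_nilpotent : Prop :=
  forall U V W : n, lie_bracket (lie_bracket U V) W = 0.

Definition lie_center : set n := [set Z | forall X, lie_bracket X Z = 0].

(* lambda = exp X.  The continuity of [gamma] ensures that, near 0, [gamma]
   stays in the domain of [phi]. *)
Definition is_exp (X : n) (lambda : N) : Prop :=
  exists gamma : R -> N,
    [/\ continuous gamma,
        forall s t, gamma (s + t) = (gamma s * gamma t)%g,
        is_derive (0 : R) (1 : R) (fun t : R => phi (gamma t)) X &
        gamma 1 = lambda].

(* [u t] is the velocity of sigma at t moved to the identity by the differential
   of the left translation by (sigma t)^-1. *)
Definition left_velocity (sigma : R -> N) (u : R -> n) : Prop :=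
  forall t, is_derive (t : R) (1 : R)
    (fun s : R => phi ((sigma t)^-1 * sigma s)%g) (u t).

(* A left-invariant metric is given by an inner product on the Lie algebra. *)
Variable g : {dot n for idfun}.

Definition lie_center_orth : set n := [set V | forall Z, lie_center Z -> g V Z = 0].

(* The Levi-Civita connection on left-invariant fields, on which it is a bilinear
   map since it is itself left-invariant.  In the compatibility with the metric
   the term X <Y, Z> vanishes, <Y, Z> being constant. *)
Record levi_civita (nabla : {bilinear n -> n -> n}) : Prop := {
  levi_civita_torsion_free : forall X Y,
    nabla X Y - nabla Y X = lie_bracket X Y;
  levi_civita_metric : forall X Y Z, g (nabla X Y) Z + g Y (nabla X Z) = 0
}.

(* In a left-invariant frame (E_i), with sigma' = \sum_i u^i E_i, one has
   nabla_sigma' sigma' = \sum_i (u^i)' E_i + \sum_(i, j) u^i u^j nabla_E_i E_j;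
   [a] is the first sum. *)
Definition magnetic_trajectory (nabla : {bilinear n -> n -> n}) (q : R)
    (F : {linear n -> n}) (sigma : R -> N) : Prop :=
  continuous sigma /\
  exists u a : R -> n,
    [/\ left_velocity sigma u,
        forall t, is_derive (t : R) (1 : R) u (a t) &
        forall t, a t + nabla (u t) (u t) = q *: F (u t)].

(* The exterior derivative of a left-invariant 2-form, on left-invariant fields;
   the terms X (omega (Y, Z)) vanish since omega (Y, Z) is constant. *)
Definition ext_deriv (omega : n -> n -> R) (X Y Z : n) : R :=
  - omega (lie_bracket X Y) Z + omega (lie_bracket X Z) Y
  - omega (lie_bracket Y Z) X.

Record lorentz_force (F : {linear n -> n}) : Prop := {
  lorentz_skew : forall U V, g (F U) V = - g U (F V);
  lorentz_closed : forall X Y Z, ext_deriv (fun U V => g (F U) V) X Y Z = 0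
}.

Definition type_II (F : {linear n -> n}) : Prop :=
  (forall V, lie_center_orth V -> lie_center (F V)) /\
  (forall Z, lie_center Z -> lie_center_orth (F Z)).

End LieAlgebra.

Definition lambda_periodic {R : realType} {N : groupTopologicalType}
    (lambda : N) (sigma : R -> N) : Prop :=
  lambda <> 1%g /\
  exists omega : R, omega <> 0 /\
    forall t, (lambda * sigma t)%g = sigma (t + omega).

(* Main.v *)
Require Import Defs.
From HB Require Import structures.
From mathcomp Require Import all_boot all_order all_algebra.
From mathcomp Require Import all_classical all_reals all_analysis.
From mathcomp Require Import lra.

Import Order.TTheory GRing.Theory Num.Theory numFieldNormedType.Exports.

Local Open Scope classical_set_scope.
Local Open Scope ring_scope.

(** The idea is to test the equation of motion against the vector [Z = F W1],
    and to measure the displacement [lambda] in the direction [V = F Z].  As [F]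
    is of type II, [Z] is central and [V] is orthogonal to the center.

    Write [u] for the velocity of the trajectory [sigma], moved to the identity.
    As [Z] is central, the connection term [<nabla_u u, Z>] vanishes
    ([levi_civita_self_central]), so [<u, Z>' = q <F u, Z> = - q <u, V>].  On the
    other hand there is a function [h] on [N] whose differential is the
    left-invariant 1-form [X |-> <X, V>] ([exists_left_invariant_primitive]).
    Hence [h (sigma t) + q^-1 <u t, Z>] is constant.  As [lambda] acts by a left
    translation, [u] is periodic, and so [h] takes the same value at
    [sigma omega = lambda sigma 0] and at [sigma 0].  But integrating the 1-form
    along [gamma t . sigma 0], where [gamma] is the one-parameter group of
    [W1 + Z1], shows that these two values differ by [<W1 + Z1, V> = <W1, V>].
    Therefore [0 = <W1, F Z> = - <F W1, F W1>].

    The primitive [h] comes from the adjoint representation [Ad], a globally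
    defined homomorphism.  Its derivative along a curve with velocity [X] is
    [Ad . ad X] ([is_derive_Ad]), and in a connected 2-step nilpotent group
    [Ad x] fixes all brackets and differs from the identity by
    central vectors only ([Ad_unipotentT]); so [Ad] has the derivative [ad X]
    itself.  A linear form that vanishes on the center, the kernel of [ad],
    factors as [l o ad] ([factor_linear]), and [h = l o Ad] is the primitive.

    The derivative of [Ad] is computed in the chart [phi], from the local
    multiplication [mul (x, y)].  Since [x y = (x y x^-1) x], the vector [Ad x Y]
    solves the linear equation [D_(Ad x Y, 0) mul (1, x) = D_(0, Y) mul (x, 1)]
    ([derive_Ad_mul_chart]).  Differentiating at [x = 1], the two sides
    contribute two mixed second derivatives of [mul], and by Schwarz's theorem
    their difference is the bracket of left-invariant fields. *)

(** * Differential calculus in normed modules *)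

Section Calculus.
Set Implicit Arguments.
Unset Strict Implicit.
Context {R : realType}.

Lemma differentiable_near_eq (V W : normedModType R) (f g : V -> W) (a : V) :
  (\near a, f a = g a) -> differentiable f a -> differentiable g a.
Proof.
move=> fg /diff_locallyP[cdf dfE]; have fga := nbhs_singleton fg.
have sh : (x + a) @[x --> (0 : V)] --> a.
  by rewrite -[X in _ --> X]add0r; apply: cvgD; [exact: cvg_id | exact: cvg_cst].
have {}fg : \forall x \near (0 : V), f (x + a) = g (x + a) := sh _ fg.
have cE : g \o shift a = cst (g a) + 'd f a +o_ 0 id.
  apply/eqaddoP => _/posnumP[eps].
  move/eqaddoP : dfE => /(_ _ (gt0 eps)) h.
  near=> x.
  suff -> : (g \o shift a - (cst (g a) + 'd f a)) x =
     (f \o shift a - (cst (f a) + 'd f a)) x by near: x.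
  rewrite !fctE /= -fga; congr (_ - _); apply/esym.
  by near: x.
have /diff_unique : continuous 'd f a by [].
move=> /(_ _ _ cE) dgE.
by apply/diff_locallyP; rewrite dgE; split.
Unshelve. all: by end_near. Qed.

Lemma continuous_near_eq (T U : topologicalType) (f g : T -> U) p :
  (\forall x \near p, f x = g x) ->
  {for p, continuous f} -> {for p, continuous g}.
Proof.
move=> fg cf; rewrite /prop_for /continuous_at -(nbhs_singleton fg).
by apply: cvg_trans cf; apply: near_eq_cvg.
Qed.

Lemma derive_chain (U V W : normedModType R) (f : U -> V) (g : V -> W) a v :
  differentiable f a -> differentiable g (f a) ->
  'D_v (g \o f) a = 'D_('D_v f a) g (f a).
Proof.
move=> df dg.
rewrite (deriveE _ (differentiable_comp df dg)) (deriveE _ df) (deriveE _ dg).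
by rewrite (diff_comp df dg).
Qed.

Lemma is_derive_chain (V W : normedModType R) (c : R -> V) (f : V -> W) t v :
  is_derive (t : R) (1 : R) c v -> differentiable f (c t) ->
  is_derive (t : R) (1 : R) (f \o c) ('D_v f (c t)).
Proof.
move=> [dc <-] df; have dc' := (derivable1_diffP _ _).1 dc.
apply: DeriveDef; last exact: derive_chain.
exact/diff_derivable/differentiable_comp.
Qed.

Lemma is_derive_pair (V W : normedModType R) (c : R -> V) (d : R -> W) t v w :
  is_derive (t : R) (1 : R) c v -> is_derive (t : R) (1 : R) d w ->
  is_derive (t : R) (1 : R) (fun s => (c s, d s)) (v, w).
Proof.
move=> [dc <-] [dd <-].
have dc' := (derivable1_diffP _ _).1 dc; have dd' := (derivable1_diffP _ _).1 dd.
have dcd := differentiable_pair dc' dd'.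
apply: DeriveDef; first exact: diff_derivable.
by rewrite !deriveE// diff_pair.
Qed.

Lemma derive_linearP (V W : normedModType R) (f : V -> W) x :
  differentiable f x -> linear (fun v => 'D_v f x).
Proof. by move=> df k u v; rewrite !deriveE// linearP. Qed.

Lemma derive_fst (U V W : normedModType R) (f : U * V -> W) a b v :
  'D_v (fun x => f (x, b)) a = 'D_(v, 0) f (a, b).
Proof.
rewrite /derive; set F := (fun h : R => _); set G := (fun h : R => _).
suff -> : F = G by []; apply/funext => h; rewrite /F /G /=.
congr (_ *: (f _ - _)); apply/eqP; rewrite xpair_eqE /=.
by rewrite scaler0 add0r !eqxx.
Qed.

Lemma derive_snd (U V W : normedModType R) (f : U * V -> W) a b v :
  'D_v (fun y => f (a, y)) b = 'D_(0, v) f (a, b).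
Proof.
rewrite /derive; set F := (fun h : R => _); set G := (fun h : R => _).
suff -> : F = G by []; apply/funext => h; rewrite /F /G /=.
congr (_ *: (f _ - _)); apply/eqP; rewrite xpair_eqE /=.
by rewrite scaler0 add0r !eqxx.
Qed.

Lemma derive_linear_fst (U V W : normedModType R) (f : U * V -> W) p :
  differentiable f p -> linear (fun u : U => 'D_(u, 0) f p).
Proof.
move=> df k u v; rewrite -(derive_linearP df).
by congr ('D_ _ _ _); apply/eqP; rewrite xpair_eqE /= scaler0 addr0 !eqxx.
Qed.

Lemma derive_linear_snd (U V W : normedModType R) (f : U * V -> W) p :
  differentiable f p -> linear (fun u : V => 'D_(0, u) f p).
Proof.
move=> df k u v; rewrite -(derive_linearP df).
by congr ('D_ _ _ _); apply/eqP; rewrite xpair_eqE /= scaler0 addr0 !eqxx.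
Qed.

Lemma derive_derive_fst (U V W : normedModType R) (f : U * V -> W) (w : U * V) a b v :
  'D_v (fun x => 'D_w f (x, b)) a = 'D_(v, 0) ('D_w f) (a, b).
Proof. exact: (derive_fst (fun p => 'D_w f p)). Qed.

Lemma derive_pair_cst (U V W : normedModType R) (f : U -> V) (b : W) x v :
  differentiable f x -> 'D_v (fun y => (f y, b)) x = ('D_v f x, 0).
Proof.
move=> df; have dc : differentiable (cst b : U -> W) x by [].
rewrite (deriveE _ (differentiable_pair df dc)) (diff_pair df dc) -(deriveE _ df).
by congr (_, _); rewrite diff_cst.
Qed.

Lemma is_derive_mxP m n (c : R -> 'M[R]_(m, n)) t D :
  is_derive (t : R) (1 : R) c D <->
  forall i j, is_derive (t : R) (1 : R) (fun s => c s i j) (D i j).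
Proof.
split=> [[dc <-] i j|h].
  rewrite derive_mx// mxE; apply: derivableP.
  exact: ((derivable_mxP _ _ _).1 dc i j).
have dc : derivable c t (1 : R) by apply/derivable_mxP => i j; have [] := h i j.
apply: DeriveDef => //; rewrite derive_mx//; apply/matrixP => i j.
by rewrite mxE; have [] := h i j.
Qed.

Lemma linear_mx_continuous m n (W : normedModType R)
  (f : {linear 'M[R]_(m, n) -> W}) : continuous f.
Proof.
have -> : (f : _ -> _) = fun M => \sum_i \sum_j M i j *: f (delta_mx i j).
  apply/funext => M; rewrite [M in LHS]matrix_sum_delta linear_sum.
  by apply: eq_bigr => i _; rewrite linear_sum; apply: eq_bigr => j _; rewrite linearZ.
apply: continuous_big => [|i _]; first exact: add_continuous.
apply: continuous_big => [|j _]; first exact: add_continuous.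
move=> M; apply: (@continuous_comp _ _ _ (fun M : 'M[R]_(m, n) => M i j)
  ( *:%R^~ (f (delta_mx i j)))); first exact: coord_continuous.
exact: scalel_continuous.
Qed.

Lemma is_derive_linear m n (W : normedModType R)
    (f : {linear 'M[R]_(m, n) -> W}) c t v :
  is_derive (t : R) (1 : R) c v -> is_derive (t : R) (1 : R) (fun s => f (c s)) (f v).
Proof.
move=> dc; have fc := @linear_mx_continuous _ _ _ f.
have df x : differentiable f x by exact: linear_differentiable.
by have := is_derive_chain dc (df _); rewrite deriveE// diff_lin.
Qed.

Lemma is_derive_mx_sub p q (f g : R -> 'M[R]_(p, q)) (t : R) a b :
  is_derive (t : R) (1 : R) f a -> is_derive (t : R) (1 : R) g b ->
  is_derive (t : R) (1 : R) (fun s => f s - g s) (a - b).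
Proof. exact: is_deriveB. Qed.

Lemma is_derive_mx_add p q (f g : R -> 'M[R]_(p, q)) (t : R) a b :
  is_derive (t : R) (1 : R) f a -> is_derive (t : R) (1 : R) g b ->
  is_derive (t : R) (1 : R) (fun s => f s + g s) (a + b).
Proof. exact: is_deriveD. Qed.

Lemma is_derive_mulr (f : R -> R) (c t d : R) :
  is_derive (t : R) (1 : R) f d -> is_derive (t : R) (1 : R) (fun s => c * f s) (c * d).
Proof. exact: is_deriveZ. Qed.

Lemma is_derive_addr (f g : R -> R) (t a b : R) :
  is_derive (t : R) (1 : R) f a -> is_derive (t : R) (1 : R) g b ->
  is_derive (t : R) (1 : R) (fun s => f s + g s) (a + b).
Proof. exact: is_deriveD. Qed.

Lemma is_derive_line (V : normedModType R) (a v : V) (t : R) :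
  is_derive (t : R) (1 : R) (fun s => s *: v + a) v.
Proof.
have d1 : differentiable (fun s : R => s *: v) t by [].
have d2 : differentiable ((fun s : R => s *: v) + cst a) t by exact: differentiableD.
apply: DeriveDef; first exact: diff_derivable.
rewrite deriveE// diffD// diff_cst /=.
by rewrite [LHS]addr0 diff_val scale1r.
Qed.

Lemma is_derive_translate (V : normedModType R) (f : R -> V) (c t : R) v :
  is_derive (t + c : R) (1 : R) f v ->
  is_derive (t : R) (1 : R) (fun s => f (s + c)) v.
Proof.
have E : (fun h : R => h^-1 *: ((f \o shift (t + c)) (h *: (1 : R)) - f (t + c))) =
    (fun h => h^-1 *: (((fun s => f (s + c)) \o shift t) (h *: (1 : R)) - f (t + c))).
  by apply/funext => h /=; rewrite addrA.
move=> [df <-]; apply: DeriveDef; first by rewrite /derivable -E.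
by rewrite /derive -E.
Qed.

Lemma eq_of_is_derive0 n (c : R -> 'rV[R]_n) :
  (forall t, 0 <= t <= 1 -> is_derive (t : R) (1 : R) c 0) -> c 1 = c 0.
Proof.
move=> dc; apply/rowP => j.
have dcj t : 0 <= t <= 1 -> is_derive (t : R) (1 : R) (fun s => c s 0 j) 0.
  by move=> /dc /is_derive_mxP/(_ 0 j); rewrite mxE.
have [||x _] := @MVT R (fun s => c s 0 j) (fun=> 0) 0 1 ltr01.
- by move=> x; rewrite in_itv/= => /andP[/ltW x0 /ltW x1]; apply: dcj; rewrite x0.
- apply: derivable_within_continuous => x; rewrite in_itv/= => x01.
  by have [] := dcj _ x01.
- by rewrite mul0r => /eqP; rewrite subr_eq0 => /eqP.
Qed.

Lemma normr_coord m n (M : 'M[R]_(m, n)) i j : `|M i j| <= `|M|.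
Proof. by rewrite [leRHS]mx_normrE; exact: (le_bigmax _ _ (i, j)). Qed.

Lemma normr_mulmx m n (v : 'rV[R]_m) (M : 'M[R]_(m, n)) :
  `|v *m M| <= m%:R * `|v| * `|M|.
Proof.
rewrite [leLHS]mx_normrE bigmax_le// => -[i j] _.
rewrite mxE (le_trans (ler_norm_sum _ _ _))//.
have -> : m%:R * `|v| * `|M| = \sum_(k < m) `|v| * `|M|.
  by rewrite sumr_const card_ord -mulrA mulr_natl.
by apply: ler_sum => k _; rewrite normrM ler_pM// normr_coord.
Qed.

(** A perturbation argument in place of the differentiability of matrix
    inversion: with [B = 1 - P], the difference quotients [r] of [q] and those
    of [k] satisfy [r = k + r B], and [B] tends to [0]; so [r] is first bounded,
    then close to [k]. *)
Lemma is_derive_of_mulmx m (q k : R -> 'rV[R]_m) (P : R -> 'M[R]_m) (t : R) K :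
  q t = 0 -> {for t, continuous P} -> P t = 1%:M ->
  (\forall s \near t, q s *m P s = k s) ->
  is_derive (t : R) (1 : R) k K -> is_derive (t : R) (1 : R) q K.
Proof.
move=> qt Pc Pt qP [dk kK].
have kt : k t = 0 by rewrite -(nbhs_singleton qP) qt mul0mx.
have kcv : h^-1 *: k (h + t) @[h --> 0^'] --> K.
  have -> : (fun h : R => h^-1 *: k (h + t)) =
            (fun h => h^-1 *: ((k \o shift t) (h *: (1 : R)) - k t)).
    by apply/funext => h; rewrite kt subr0 /= [h%:A]mulr1.
  by rewrite -kK; exact: dk.
have sh : (h + t) @[h --> 0^'] --> t.
  rewrite -[X in _ --> X]add0r; apply: cvgD; last exact: cvg_cst.
  exact: nbhs_dnbhs.
suff qcv : h^-1 *: q (h + t) @[h --> 0^'] --> K.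
  have E : (fun h : R => h^-1 *: q (h + t)) =
            (fun h => h^-1 *: ((q \o shift t) (h *: (1 : R)) - q t)).
    by apply/funext => h; rewrite qt subr0 /= [h%:A]mulr1.
  rewrite E in qcv.
  by apply: DeriveDef; [apply/cvg_ex; exists K | exact: cvg_lim qcv].
apply/cvgrPdist_lt => e e0.
pose C := `|K| + 1; have C0 : 0 < C by rewrite ltr_wpDl.
(* The first bound makes [|r B| <= |r| / 2], hence [|r| <= 2 C]; the second
   then makes [|r B| <= e / 2]. *)
pose d := Num.min (1 / (2 * m.+1%:R)) (e / (4 * m.+1%:R * C)).
have d0 : 0 < d.
  by rewrite lt_min !divr_gt0// ?mulr_gt0.
have Bs : \forall h \near (0 : R)^', `|1%:M - P (h + t)| < d.
  by move/cvgrPdist_lt : Pc => /(_ _ d0); rewrite Pt; exact: sh.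
have {}qP : \forall h \near (0 : R)^', q (h + t) *m P (h + t) = k (h + t) := sh _ qP.
have e2 : 0 < e / 2 by rewrite divr_gt0.
near=> h.
have qPh : h^-1 *: q (h + t) *m P (h + t) = h^-1 *: k (h + t).
  by rewrite -scalemxAl; congr (_ *: _); near: h.
have Bh : `|1%:M - P (h + t)| < d by near: h.
have k1 : `|K - h^-1 *: k (h + t)| < 1.
  by near: h; move/cvgrPdist_lt : kcv; apply.
have ke : `|K - h^-1 *: k (h + t)| < e / 2.
  by near: h; move/cvgrPdist_lt : kcv; apply.
set r := h^-1 *: q (h + t) in qPh *; set kh := h^-1 *: k (h + t) in qPh k1 ke *.
set B := 1%:M - P (h + t) in Bh.
have rE : r = kh + r *m B by rewrite /B mulmxBr mulmx1 qPh addrC subrK.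
have khC : `|kh| <= C.
  rewrite -[kh](subKr K) (le_trans (ler_normB _ _))// lerD// ltW//.
have rB : `|r *m B| <= m.+1%:R * `|r| * `|B|.
  rewrite (le_trans (normr_mulmx _ _))// ler_wpM2r// ler_wpM2r// ler_nat//.
have [Bd1 Bd2] : m.+1%:R * `|B| <= 1 / 2 /\ 4 * (m.+1%:R * `|B|) * C <= e.
  move: (ltW Bh); rewrite /d le_min ler_pdivlMr ?mulr_gt0// ler_pdivlMr ?mulr_gt0//.
  by move=> /andP[h1 h2]; split; lra.
have rC : `|r| <= 2 * C.
  have : `|r| <= C + `|r *m B| by rewrite {1}rE (le_trans (ler_normD _ _))// lerD.
  have : `|r| * (m.+1%:R * `|B|) <= `|r| * (1 / 2) by rewrite ler_wpM2l.
  by move: rB; lra.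
have rBe : `|r *m B| <= e / 2.
  have : `|r| * (m.+1%:R * `|B|) <= 2 * C * (m.+1%:R * `|B|) by rewrite ler_wpM2r// mulr_ge0.
  by move: rB Bd2; lra.
rewrite rE opprD addrA (splitr e) (le_lt_trans (ler_normB _ _))//.
by rewrite ltr_leD.
Unshelve. all: by end_near. Qed.

(** * Equality of mixed second derivatives *)

(** Two applications of the mean value theorem, in the direction [v] and then
    in the direction [w].  The left-hand side being symmetric in [v] and [w],
    Schwarz's theorem follows. *)
Lemma second_difference (V : normedModType R) (f : V -> R) (p v w : V) (r h : R) :
  (forall x, ball p r x -> differentiable f x /\ differentiable ('D_v f) x) ->
  0 < h -> h * (`|v| + `|w|) < r ->
  exists2 x, ball p r x &
    f (h *: v + (h *: w + p)) - f (h *: v + p) - (f (h *: w + p) - f p) =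
    h ^+ 2 * 'D_w ('D_v f) x.
Proof.
move=> df h0 hr.
have inb (s t : R) : 0 <= s <= h -> 0 <= t <= h -> ball p r (s *: v + (t *: w + p)).
  move=> /andP[s0 sh] /andP[t0 th]; rewrite -ball_normE /= addrA opprD addrCA subrr addr0.
  rewrite normrN (le_lt_trans (ler_normD _ _))// !normrZ !ger0_norm//.
  by rewrite (le_lt_trans _ hr)// mulrDr lerD// ler_wpM2r.
have inb0 (s : R) : 0 <= s <= h -> ball p r (s *: v + p).
  by move=> sh; have := inb s 0 sh; rewrite scale0r add0r lexx ltW//; exact.
pose G (s : R) : R := f (s *: v + (h *: w + p)) - f (s *: v + p).
pose dG (s : R) : R := 'D_v f (s *: v + (h *: w + p)) - 'D_v f (s *: v + p).
have dGP (s : R) : 0 <= s <= h -> is_derive (s : R) (1 : R) G (dG s).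
  move=> sh; apply: is_deriveB.
    have := is_derive_chain (f := f) (is_derive_line (h *: w + p) v s).
    by apply; have [|//] := df _ (inb s h sh _); rewrite ltW//=.
  have := is_derive_chain (f := f) (is_derive_line p v s).
  by apply; have [] := df _ (inb0 s sh).
have [||x xh Ex] := @MVT R G dG 0 h h0.
- by move=> x; rewrite in_itv/= => /andP[/ltW x0 /ltW x1]; apply: dGP; rewrite x0.
- apply: derivable_within_continuous => x; rewrite in_itv/= => x01.
  by have [] := dGP _ x01.
have {}xh : 0 <= x <= h by move: xh; rewrite in_itv/= => /andP[/ltW-> /ltW->].
pose H (s : R) : R := 'D_v f (s *: w + (x *: v + p)).
pose dH (s : R) : R := 'D_w ('D_v f) (s *: w + (x *: v + p)).
have dHP (s : R) : 0 <= s <= h -> is_derive (s : R) (1 : R) H (dH s).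
  move=> sh.
  have := is_derive_chain (f := 'D_v f) (is_derive_line (x *: v + p) w s).
  by apply; rewrite addrCA; have [] := df _ (inb x s xh sh).
have [||y yh Ey] := @MVT R H dH 0 h h0.
- by move=> y; rewrite in_itv/= => /andP[/ltW x0 /ltW x1]; apply: dHP; rewrite x0.
- apply: derivable_within_continuous => y; rewrite in_itv/= => x01.
  by have [] := dHP _ x01.
exists (y *: w + (x *: v + p)).
  by rewrite addrCA; apply: inb => //; move: yh; rewrite in_itv/= => /andP[/ltW-> /ltW->].
have Hd : H h - H 0 = dG x by rewrite /H /dG scale0r add0r addrCA.
move: Ex; rewrite -Hd Ey /G /dH !subr0 scale0r !add0r => ->.
by rewrite -mulrA -expr2 mulrC.
Qed.

Lemma ler_dist_half (a b c e : R) :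
  `|a - b| < e / 2 -> `|c - b| < e / 2 -> `|a - c| <= e.
Proof.
move=> h1 h2; rewrite -(subrKA b) (le_trans (ler_normD _ _))//.
by rewrite (splitr e) lerD// ltW// distrC.
Qed.

Lemma schwarz_real (V : normedModType R) (f : V -> R) (p v w : V) :
  (\forall x \near p, [/\ differentiable f x, differentiable ('D_v f) x &
     differentiable ('D_w f) x]) ->
  {for p, continuous ('D_w ('D_v f))} -> {for p, continuous ('D_v ('D_w f))} ->
  'D_w ('D_v f) p = 'D_v ('D_w f) p.
Proof.
move=> df c1 c2; apply/eqP; rewrite -subr_eq0 -normr_le0; apply/ler_addgt0Pl => e e0.
rewrite addr0.
have e2 : 0 < e / 2 by rewrite divr_gt0.
move/cvgrPdist_lt/(_ _ e2): c1 => c1; move/cvgrPdist_lt/(_ _ e2): c2 => c2.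
have /nbhs_ballP[r /= r0 rP] : nbhs p [set x |
    [/\ differentiable f x, differentiable ('D_v f) x & differentiable ('D_w f) x] /\
    `|'D_w ('D_v f) p - 'D_w ('D_v f) x| < e / 2 /\
    `|'D_v ('D_w f) p - 'D_v ('D_w f) x| < e / 2].
  by apply: filterI df _; apply: filterI c1 c2.
have vw0 : 0 < `|v| + `|w| + 1 by rewrite ltr_wpDl// addr_ge0.
pose h := r / (`|v| + `|w| + 1).
have h0 : 0 < h by rewrite divr_gt0.
have hr : h * (`|v| + `|w|) < r.
  by rewrite /h mulrAC ltr_pdivrMr// ltr_pM2l// ltrDl.
have [|x xr Ex] := second_difference (f := f) (p := p) (v := v) (w := w) (r := r) (h := h) _ h0 hr.
  by move=> y /rP[[]].
have [||y yr Ey] := second_difference (f := f) (p := p) (v := w) (w := v) (r := r) (h := h) _ h0.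
- by move=> y /rP[[]].
- by rewrite addrC.
have E : 'D_w ('D_v f) x = 'D_v ('D_w f) y.
  have hh : h ^+ 2 != 0 by rewrite expf_neq0// gt_eqF.
  have EE : h *: w + (h *: v + p) = h *: v + (h *: w + p) by rewrite addrCA.
  rewrite EE in Ey; apply: (mulfI hh).
  move: Ex Ey; move: ('D_w _ x) ('D_v _ y) (f (_ + (_ + _))) (f (_ *: v + p)).
  by move: (f (_ + _)) (f p) => a b X Y c d; lra.
have [_ [/= X _]] := rP _ xr; have [_ [_ /= Y]] := rP _ yr.
rewrite -E in Y; exact: ler_dist_half X Y.
Qed.

Lemma derive_coord (V : normedModType R) m n (f : V -> 'M[R]_(m, n)) (p v : V) i j :
  differentiable f p -> 'D_v (fun x => f x i j) p = 'D_v f p i j.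
Proof. by move=> df; rewrite derive_mx ?mxE//; exact: diff_derivable. Qed.

Lemma differentiable_coord_comp (V : normedModType R) m n (f : V -> 'M[R]_(m, n))
    (p : V) i j :
  differentiable f p -> differentiable (fun x => f x i j) p.
Proof.
move=> df; apply: (differentiable_comp (g := fun M : 'M[R]_(m, n) => M i j)) => //.
exact: differentiable_coord.
Qed.

Lemma continuous_coord_comp (T : topologicalType) m n (f : T -> 'M[R]_(m, n)) p i j :
  {for p, continuous f} -> {for p, continuous (fun x => f x i j : R)}.
Proof.
move=> cf; apply: (continuous_comp (g := fun M : 'M[R]_(m, n) => M i j)) => //.
exact: coord_continuous.
Qed.

Lemma schwarz (V : normedModType R) m n (f : V -> 'M[R]_(m, n)) (p v w : V) :
  (\forall x \near p, [/\ differentiable f x, differentiable ('D_v f) x &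
     differentiable ('D_w f) x]) ->
  {for p, continuous ('D_w ('D_v f))} -> {for p, continuous ('D_v ('D_w f))} ->
  'D_w ('D_v f) p = 'D_v ('D_w f) p.
Proof.
move=> df c1 c2; apply/matrixP => i j.
pose fij x := f x i j.
have df1 : \forall x \near p, \forall y \near x, [/\ differentiable f y,
    differentiable ('D_v f) y & differentiable ('D_w f) y].
  exact/near_join.
have dv : \forall x \near p, \forall y \near x, 'D_v fij y = 'D_v f y i j.
  near=> x; have : \forall y \near x, differentiable f y.
    by apply: filterS (near df1 x _) => // y [].
  by apply: filterS => y; exact: derive_coord.
have dw : \forall x \near p, \forall y \near x, 'D_w fij y = 'D_w f y i j.
  near=> x; have : \forall y \near x, differentiable f y.
    by apply: filterS (near df1 x _) => // y [].
  by apply: filterS => y; exact: derive_coord.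
have dvw : \forall x \near p, 'D_w ('D_v fij) x = 'D_w ('D_v f) x i j.
  near=> x; rewrite (near_eq_derive _ (near dv x _))//.
  by rewrite derive_coord//; have [] := near df x _.
have dwv : \forall x \near p, 'D_v ('D_w fij) x = 'D_v ('D_w f) x i j.
  near=> x; rewrite (near_eq_derive _ (near dw x _))//.
  by rewrite derive_coord//; have [] := near df x _.
have e1 := nbhs_singleton dvw; have e2 := nbhs_singleton dwv.
refine (etrans (esym e1) (etrans _ e2)); apply: schwarz_real.
- apply: filterS3 df dv dw => x [d1 d2 d3] dvx dwx; split.
  + exact: differentiable_coord_comp.
  + apply: (differentiable_near_eq (f := fun x => 'D_v f x i j)).
      by apply: filterS dvx => y ->.
    exact: differentiable_coord_comp.
  + apply: (differentiable_near_eq (f := fun x => 'D_w f x i j)).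
      by apply: filterS dwx => y ->.
    exact: differentiable_coord_comp.
- have dvw' : \forall x \near p, 'D_w ('D_v f) x i j = 'D_w ('D_v fij) x by apply: filterS dvw.
  exact: (continuous_near_eq dvw' (continuous_coord_comp (i := i) (j := j) c1)).
- have dwv' : \forall x \near p, 'D_v ('D_w f) x i j = 'D_v ('D_w fij) x by apply: filterS dwv.
  exact: (continuous_near_eq dwv' (continuous_coord_comp (i := i) (j := j) c2)).
Unshelve. all: by end_near. Qed.

End Calculus.

(** * Linear algebra of row vectors *)

Section LinearAlgebra.
Set Implicit Arguments.
Unset Strict Implicit.
Context {R : fieldType}.

(** The generalized inverse of the matrix of [f] lifts an element of the image
    of [f] to a preimage, which is defined up to the kernel. *)
Lemma factor_linear (W : lmodType R) p q (f : {linear 'rV[R]_p -> 'rV[R]_q})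
    (k : {linear 'rV[R]_p -> W}) :
  (forall X, f X = 0 -> k X = 0) ->
  exists l : {linear 'rV[R]_q -> W}, forall X, l (f X) = k X.
Proof.
move=> fk; pose M := lin1_mx f.
exists (k \o mulmxr (pinvmx M)) => X /=.
apply/eqP; rewrite -subr_eq0 -linearB; apply/eqP/fk; rewrite linearB /=.
rewrite -(mul_rV_lin1 f (f X *m _)) -/M mulmxKpV ?subrr//.
by rewrite -(mul_rV_lin1 f X) submxMl.
Qed.

Lemma linear_rows p q r (f : 'I_p -> 'rV[R]_q -> 'rV[R]_r) :
  (forall i, linear (f i)) -> linear (fun X => mxvec (\matrix_(i < p) f i X)).
Proof.
move=> fl a U V; rewrite -linearP; congr mxvec; apply/row_matrixP => i.
by rewrite [RHS]linearP /= !rowK fl.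
Qed.

End LinearAlgebra.

Section LieGroup.
Set Implicit Arguments.
Unset Strict Implicit.
Context {R : realType} {N : groupTopologicalType} {m : nat}.
Context (A : set (@chart R N m)) (hN : lie_group A).

(** * Translations and conjugations in charts *)

Lemma chart_imgK (c : @chart R N m) y :
  chart_img c y -> chart_dom c (chart_inv c y) /\ c (chart_inv c y) = y.
Proof. by move=> [x dx <-]; rewrite chart_mapK. Qed.

Lemma chart_img_map (c : @chart R N m) x : chart_dom c x -> chart_img c (c x).
Proof. by exists x. Qed.

Lemma near_chart_dom (c : @chart R N m) x :
  chart_dom c x -> \forall y \near x, chart_dom c y.
Proof. by move=> dx; apply: open_nbhs_nbhs; split=> //; exact: chart_dom_open. Qed.

Lemma near_chart_img (c : @chart R N m) x :
  chart_dom c x -> \forall y \near c x, chart_img c y.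
Proof.
move=> dx; apply: open_nbhs_nbhs; split; first exact: chart_img_open.
exact: chart_img_map.
Qed.

Lemma chart_inv_cvg (c : @chart R N m) x :
  chart_dom c x -> chart_inv c y @[y --> c x] --> x.
Proof.
move=> dx; rewrite -[X in _ --> X](chart_mapK dx).
exact/chart_inv_continuous/chart_img_map.
Qed.

Lemma cvg_mulg (T : Type) (G : set_system T) {FG : Filter G} (f g : T -> N) x y :
  f @ G --> x -> g @ G --> y -> (f t * g t)%g @[t --> G] --> (x * y)%g.
Proof.
move=> fx gy.
apply: (continuous2_cvg (h := fun a b : N => (a * b)%g) FG _ fx gy).
exact: (lie_group_mul_continuous hN (x := (x, y))).
Qed.

(** A connected group is generated by any neighbourhood of the identity: a
    subgroup that contains one is both open and closed. *)
Lemma path_connected_group_ind (P : set N) : @path_connected R N ->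
  (\forall x \near (1%g : N), P x) ->
  (forall x y, P x -> P y -> P (x * y)%g) -> (forall x, P x -> P x^-1%g) ->
  forall x, P x.
Proof.
move=> pc P1 PM PV x; have Pe := nbhs_singleton P1.
have near1 (y : N) : \forall z \near y, P (y^-1 * z)%g.
  have yz : (y^-1 * z)%g @[z --> y] --> (1%g : N).
    rewrite -[X in _ --> X](mulVg y).
    exact: cvg_mulg (cvg_cst _) cvg_id.
  exact: yz P1.
have oP : open P.
  rewrite openE => y Py; apply: filterS (near1 y) => z Pz.
  by rewrite -[z](mulVKg y); exact: PM.
have cP : closed P.
  rewrite -[P]setCK; apply: open_closedC; rewrite openE => y nPy.
  apply: filterS (near1 y) => z Pz Pz'; apply: nPy.
  have -> : y = (z * (y^-1 * z)^-1)%g by rewrite invgM invgK mulVKg.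
  by apply: PM => //; exact: PV.
have [c [cc c0 c1]] := pc 1%g x.
have conn := connected_continuous_connected (@segment_connected R 0 1) cc.
have := conn ((c @` `[0, 1]) `&` P).
have in0 : (c @` `[0, 1]) 1%g by exists 0 => //=; rewrite in_itv/= lexx ler01.
have in1 : (c @` `[0, 1]) x by exists 1 => //=; rewrite in_itv/= lexx ler01.
move=> /(_ (ex_intro _ 1%g (conj in0 Pe)) (ex_intro2 _ _ P oP erefl) (ex_intro2 _ _ P cP erefl)) E.
by move: in1; rewrite -E => -[].
Qed.

Lemma differentiable_mulgl (c d : @chart R N m) a b :
  A c -> A d -> chart_dom c b -> chart_dom d (a * b)%g ->
  differentiable (fun y => d (a * chart_inv c y)%g) (c b).
Proof.
move=> Ac Ad cb dab; have [c1 Ac1 c1a] := atlas_cover (lie_group_atlas hN) a.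
have [sm _] := lie_group_mul_smooth hN Ac1 Ac Ad 1%N.
have S : chart_dom d (chart_inv c1 (c1 a) * chart_inv c (c b))%g by rewrite !chart_mapK.
have df := sm (c1 a, c b) (And3 (chart_img_map c1a) (chart_img_map cb) S).
have dp : differentiable (fun y : 'rV[R]_m => (c1 a, y)) (c b).
  by apply: differentiable_pair.
have := differentiable_comp dp df.
by rewrite /comp /= chart_mapK.
Qed.

Lemma differentiable_mulgr (c d : @chart R N m) a b :
  A c -> A d -> chart_dom c b -> chart_dom d (b * a)%g ->
  differentiable (fun y => d (chart_inv c y * a)%g) (c b).
Proof.
move=> Ac Ad cb dab; have [c1 Ac1 c1a] := atlas_cover (lie_group_atlas hN) a.
have [sm _] := lie_group_mul_smooth hN Ac Ac1 Ad 1%N.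
have S : chart_dom d (chart_inv c (c b) * chart_inv c1 (c1 a))%g by rewrite !chart_mapK.
have df := sm (c b, c1 a) (And3 (chart_img_map cb) (chart_img_map c1a) S).
have dp : differentiable (fun y : 'rV[R]_m => (y, c1 a)) (c b).
  by apply: differentiable_pair.
have := differentiable_comp dp df.
by rewrite /comp /= chart_mapK.
Qed.

Context (phi : @chart R N m) (hphi : A phi) (hphi1 : chart_dom phi 1%g).
Local Notation n := 'rV[R]_m.
Local Notation psi := (chart_inv phi).
Local Notation e := (phi 1%g).

Lemma chart_inv_cvg1 : psi y @[y --> e] --> (1%g : N).
Proof. exact: chart_inv_cvg. Qed.

Lemma chart_inv_map1 : psi e = 1%g.
Proof. exact: chart_mapK. Qed.

(** * The adjoint representation *)

Definition conj_chart (x : N) (y : 'rV[R]_m) : 'rV[R]_m :=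
  phi (x * psi y * x^-1)%g.

Definition Ad (x : N) (Y : 'rV[R]_m) : 'rV[R]_m := 'D_Y (conj_chart x) e.

Lemma conj_chart_e x : conj_chart x e = e.
Proof. by rewrite /conj_chart chart_inv_map1 mulg1 mulgV. Qed.

Lemma conj_cvg1 x : (x * psi y * x^-1)%g @[y --> e] --> (1%g : N).
Proof.
have xc : (x * psi y)%g @[y --> e] --> (x * 1)%g.
  exact: cvg_mulg (cvg_cst _) chart_inv_cvg1.
have := cvg_mulg xc (cvg_cst (x^-1)%g).
by rewrite mulg1 mulgV; exact.
Qed.

Lemma near_conj_dom x : \forall y \near e, chart_dom phi (x * psi y * x^-1)%g.
Proof. exact: conj_cvg1 (near_chart_dom hphi1). Qed.

(** The element [x] may lie outside the domain of [phi], so the conjugation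
    factors through a chart [c] at [x]: [y |-> x y |-> x y x^-1]. *)
Lemma differentiable_conj x : differentiable (conj_chart x) e.
Proof.
have [c Ac cx] := atlas_cover (lie_group_atlas hN) x.
have cx1 : chart_dom c (x * 1)%g by rewrite mulg1.
have cxx : chart_dom phi (x * x^-1)%g by rewrite mulgV.
have d1 := differentiable_mulgl hphi Ac hphi1 cx1.
have d2 := differentiable_mulgr Ac hphi cx cxx.
have E : c x = (fun y => c (x * psi y)%g) e by rewrite chart_inv_map1 mulg1.
rewrite E in d2; have := differentiable_comp d1 d2.
apply: differentiable_near_eq.
have xc : (x * psi y)%g @[y --> e] --> (x * 1)%g.
  exact: cvg_mulg (cvg_cst _) chart_inv_cvg1.
have dm : \forall y \near e, chart_dom c (x * psi y)%g := xc _ (near_chart_dom cx1).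
by apply: filterS dm => y dy; rewrite /= chart_mapK.
Qed.

Lemma Ad_linear x : linear (Ad x).
Proof. exact: derive_linearP (differentiable_conj x). Qed.

HB.instance Definition _ x := GRing.isLinear.Build _ _ _ _ (Ad x) (Ad_linear x).

Lemma AdM x y Y : Ad (x * y)%g Y = Ad x (Ad y Y).
Proof.
have dx := differentiable_conj x; rewrite -(conj_chart_e y) in dx.
have := derive_chain Y (differentiable_conj y) dx.
rewrite /Ad conj_chart_e => <-; apply: near_eq_derive.
apply: filterS (near_conj_dom y) => z dz.
by rewrite /conj_chart /= chart_mapK// invgM !mulgA.
Qed.

Lemma Ad1 Y : Ad 1%g Y = Y.
Proof.
rewrite -[RHS](derive_id e Y); apply: near_eq_derive.
apply: filterS (near_chart_img hphi1) => y /chart_imgK[_ yE].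
by rewrite /conj_chart mul1g invg1 mulg1.
Qed.

Lemma AdK x Y : Ad (x^-1)%g (Ad x Y) = Y.
Proof. by rewrite -AdM mulVg Ad1. Qed.

Lemma AdKV x Y : Ad x (Ad (x^-1)%g Y) = Y.
Proof. by rewrite -AdM mulgV Ad1. Qed.

(** * The local multiplication and the bracket *)

Definition mul_chart (p : 'rV[R]_m * 'rV[R]_m) : 'rV[R]_m :=
  phi (psi p.1 * psi p.2)%g.

Lemma near_mul_chart : \forall p \near (e, e),
  [/\ differentiable mul_chart p,
      forall v, differentiable ('D_v mul_chart) p &
      forall v w, {for p, continuous ('D_w ('D_v mul_chart))}].
Proof.
have [sm1 sm2] := lie_group_mul_smooth hN hphi hphi hphi 2%N.
pose S := [set p : 'rV[R]_m * 'rV[R]_m |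
              [/\ chart_img phi p.1, chart_img phi p.2 &
                  chart_dom phi (psi p.1 * psi p.2)%g]].
suff : \forall p \near (e, e), S p.
  apply: filterS => p Sp; split; first exact: sm1.
    by move=> v; have [+ _] := sm2 v; apply.
  by move=> v w; have [_ /(_ w)] := sm2 v; apply.
have p1 : p.1 @[p --> ((e, e) : 'rV[R]_m * 'rV[R]_m)] --> e by exact: cvg_fst.
have p2 : p.2 @[p --> ((e, e) : 'rV[R]_m * 'rV[R]_m)] --> e by exact: cvg_snd.
have pm : (psi p.1 * psi p.2)%g @[p --> ((e, e) : 'rV[R]_m * 'rV[R]_m)] --> (1%g : N).
  rewrite -[X in _ --> X]mulg1.
  exact: cvg_mulg (cvg_comp _ _ p1 chart_inv_cvg1) (cvg_comp _ _ p2 chart_inv_cvg1).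
have n1 : \forall p \near ((e, e) : 'rV[R]_m * 'rV[R]_m), chart_img phi p.1 :=
  p1 _ (near_chart_img hphi1).
have n2 : \forall p \near ((e, e) : 'rV[R]_m * 'rV[R]_m), chart_img phi p.2 :=
  p2 _ (near_chart_img hphi1).
have n3 : \forall p \near ((e, e) : 'rV[R]_m * 'rV[R]_m),
  chart_dom phi (psi p.1 * psi p.2)%g := pm _ (near_chart_dom hphi1).
by apply: filterS3 n1 n2 n3.
Qed.

Lemma differentiable_derive_mul_chart (v : n * n) :
  differentiable ('D_v mul_chart) (e, e).
Proof. by have [_ + _] := nbhs_singleton near_mul_chart; apply. Qed.

(** With [v = (X, 0)] and [w = (0, Y)] this is the mixed second derivative of
    the group law, whose antisymmetrization in [X] and [Y] is the bracket. *)
Definition mul_hessian (v w : n * n) : n := 'D_v ('D_w mul_chart) (e, e).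

Lemma mul_hessianC v w : mul_hessian v w = mul_hessian w v.
Proof.
have [_ _ cont] := nbhs_singleton near_mul_chart.
apply: schwarz; [|exact: cont|exact: cont].
by apply: filterS near_mul_chart => p [d1 d2 _].
Qed.

Lemma mul_hessian_fstP w : linear (fun U : n => mul_hessian (U, 0) w).
Proof. exact: derive_linear_fst (differentiable_derive_mul_chart w). Qed.

Lemma mul_hessian_sndP w : linear (fun U : n => mul_hessian (0, U) w).
Proof. exact: derive_linear_snd (differentiable_derive_mul_chart w). Qed.

(** Used for [f = mul_chart (e, _)] and [f = mul_chart (_, e)], which agree with
    the identity on the image of [phi] only. *)
Lemma derive_id_near (f : n -> n) (v : n) :
  (forall y, chart_dom phi (psi y) -> f y = phi (psi y)) -> 'D_v f e = v.
Proof.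
move=> fE; rewrite -[RHS](derive_id e v); apply: near_eq_derive.
by apply: filterS (near_chart_img hphi1) => y /chart_imgK[dy yE]; rewrite fE.
Qed.

Lemma derive_mul_chart_r (v : n) : 'D_(0, v) mul_chart (e, e) = v.
Proof.
rewrite -derive_snd; apply: derive_id_near => y _.
by rewrite /mul_chart /= chart_inv_map1 mul1g.
Qed.

Lemma derive_mul_chart_l (v : n) : 'D_(v, 0) mul_chart (e, e) = v.
Proof.
rewrite -derive_fst; apply: derive_id_near => y _.
by rewrite /mul_chart /= chart_inv_map1 mulg1.
Qed.

Lemma left_invariant_fieldE (X : n) :
  left_invariant_field phi X = (fun x => 'D_(0, X) mul_chart (x, e)).
Proof. by apply/funext => x; rewrite -derive_snd. Qed.

Lemma lie_bracketE (X Y : n) :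
  lie_bracket phi X Y = mul_hessian (X, 0) (0, Y) - mul_hessian (Y, 0) (0, X).
Proof.
rewrite /lie_bracket /field_bracket !left_invariant_fieldE !derive_mul_chart_r.
by rewrite !derive_derive_fst.
Qed.

Lemma lie_bracketC (X Y : n) : lie_bracket phi X Y = - lie_bracket phi Y X.
Proof. by rewrite !lie_bracketE opprB. Qed.

Lemma lie_bracket_linearl (Y : n) : linear (fun X => lie_bracket phi X Y).
Proof.
move=> k U V; rewrite !lie_bracketE !(mul_hessianC (Y, 0)).
rewrite (mul_hessian_fstP (0, Y)) (mul_hessian_sndP (Y, 0)).
have E (a b c d : n) : k *: a + b - (k *: c + d) = k *: (a - c) + (b - d).
  by rewrite scalerBr opprD addrACA.
exact: E.
Qed.

Lemma lie_bracket_linearr X : linear (lie_bracket phi X).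
Proof.
move=> k U V; rewrite !(lie_bracketC X).
have E (a b : n) : - (k *: a + b) = k *: - a + - b by rewrite opprD scalerN.
rewrite -E; congr (- _); exact: (lie_bracket_linearl X).
Qed.

(** * The derivative of the adjoint representation *)

(** The derivative at [y = 1] of the identity [(x y x^-1) x = x y].  It
    determines [Ad x Y] through first derivatives of the multiplication. *)
Lemma derive_Ad_mul_chart (x : n) Y : chart_img phi x ->
  differentiable mul_chart (e, x) ->
  'D_(Ad (psi x) Y, 0) mul_chart (e, x) = 'D_(0, Y) mul_chart (x, e).
Proof.
move=> /chart_imgK[dx xE] dm.
have dc := differentiable_conj (psi x).
have dp : differentiable (fun y : n => (conj_chart (psi x) y, x)) e.
  by apply: differentiable_pair.
have DE : 'D_Y (fun y : n => (conj_chart (psi x) y, x)) e = (Ad (psi x) Y, 0).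
  exact: derive_pair_cst.
rewrite -DE -derive_snd.
have := derive_chain (g := mul_chart) Y dp; rewrite conj_chart_e => /(_ dm) <-.
apply: near_eq_derive; apply: filterS (near_conj_dom (psi x)) => y dy.
by rewrite /mul_chart /conj_chart /= chart_mapK// mulgVK.
Qed.

(** With [x = phi (tau s)] and [P] the matrix of [D_(_, 0) mul (e, x)],
    [derive_Ad_mul_chart] gives [(Ad (tau s) Y - Y) P = D_(0, Y) mul (x, e) -
    D_(Y, 0) mul (e, x)], and [P] is the identity at [s = t].  So the left factor
    has the derivative of the right-hand side, which is a difference of two
    values of [mul_hessian]; the symmetry of the latter turns it into the
    bracket. *)
Lemma is_derive_Ad1 (tau : R -> N) (t : R) X Y :
  {for t, continuous tau} -> tau t = 1%g ->
  is_derive (t : R) (1 : R) (fun s => phi (tau s)) X ->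
  is_derive (t : R) (1 : R) (fun s => Ad (tau s) Y) (lie_bracket phi X Y).
Proof.
move=> ctau tau1 dx; pose x s := phi (tau s).
have xt : x t = e by rewrite /x tau1.
have cx : {for t, continuous x}.
  apply: differentiable_continuous; apply/derivable1_diffP.
  by case: dx.
pose P s := \matrix_(i < m) 'D_(delta_mx 0 i, 0) mul_chart (e, x s).
pose q s := Ad (tau s) Y - Y.
pose k1 s := 'D_(0, Y) mul_chart (x s, e).
pose k2 s := 'D_(Y, 0) mul_chart (e, x s).
have dex : is_derive (t : R) (1 : R) (fun s => (e, x s)) (0, X).
  by apply: is_derive_pair.
have dxe : is_derive (t : R) (1 : R) (fun s => (x s, e)) (X, 0).
  by apply: is_derive_pair.
have drv v : is_derive (t : R) (1 : R) (fun s => 'D_v mul_chart (e, x s))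
     (mul_hessian (0, X) v).
  have := is_derive_chain (f := 'D_v mul_chart) dex.
  by rewrite xt; apply; exact: differentiable_derive_mul_chart.
have dk1 : is_derive (t : R) (1 : R) k1 (mul_hessian (X, 0) (0, Y)).
  have := is_derive_chain (f := 'D_(0, Y) mul_chart) dxe.
  by rewrite xt; apply; exact: differentiable_derive_mul_chart.
have dk2 : is_derive (t : R) (1 : R) k2 (mul_hessian (0, X) (Y, 0)) := drv (Y, 0).
have E : lie_bracket phi X Y = mul_hessian (X, 0) (0, Y) - mul_hessian (0, X) (Y, 0).
  by rewrite lie_bracketE (mul_hessianC (Y, 0)).
have dk : is_derive (t : R) (1 : R) (fun s => k1 s - k2 s) (lie_bracket phi X Y).
  rewrite E; exact: (is_derive_mx_sub dk1 dk2).
suff dq : is_derive (t : R) (1 : R) q (lie_bracket phi X Y).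
  have -> : (fun s => Ad (tau s) Y) = (fun s => q s + Y).
    by apply/funext => s; rewrite subrK.
  by rewrite -[lie_bracket _ _ _]addr0; exact: (is_derive_mx_add dq (is_derive_cst Y t 1)).
refine (is_derive_of_mulmx (P := P) _ _ _ _ dk).
- by rewrite /q tau1 Ad1 subrr.
- apply: differentiable_continuous; apply/derivable1_diffP.
  suff [] : is_derive (t : R) (1 : R) P
    (\matrix_(i < m) mul_hessian (0, X) (delta_mx 0 i, 0)) by [].
  apply/is_derive_mxP => i j; rewrite !mxE.
  under eq_fun do rewrite mxE.
  by have /is_derive_mxP/(_ 0 j) := drv (delta_mx 0 i, 0).
- by apply/row_matrixP => i; rewrite rowK xt derive_mul_chart_l row1.
have n1 : \forall s \near t, chart_dom phi (tau s).
  by apply: ctau; rewrite tau1; exact: near_chart_dom.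
have n2 : \forall s \near t, differentiable mul_chart (e, x s).
  have cex : (e, x s) @[s --> t] --> (e, e).
    have cx1 : x s @[s --> t] --> e by rewrite -[X in _ --> X]xt; exact: cx.
    exact: (@cvg_pair _ _ _ _ (nbhs e) (nbhs e) _ _ _ (fun=> e) x (cvg_cst _) cx1).
  have dee : \forall p \near (e, e), differentiable mul_chart p.
    by apply: filterS near_mul_chart => p [].
  exact: cex dee.
apply: filterS2 n1 n2 => s ds dms.
have psx : psi (x s) = tau s by rewrite /x chart_mapK.
have dAd : 'D_(Ad (tau s) Y, 0) mul_chart (e, x s) = 'D_(0, Y) mul_chart (x s, e).
  by rewrite -(derive_Ad_mul_chart Y (chart_img_map ds) dms) psx.
have l1 := derive_linear_fst dms.
have PE v : v *m P s = 'D_(v, 0) mul_chart (e, x s).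
  pose L : {linear n -> n} := HB.pack (fun v : n => 'D_(v, 0) mul_chart (e, x s))
     (GRing.isLinear.Build _ _ _ _ _ l1).
  rewrite -[RHS]/(L v) [v in RHS]row_sum_delta linear_sum mulmx_sum_row.
  by apply: eq_bigr => i _; rewrite linearZ rowK.
by rewrite mulmxBl !PE dAd.
Qed.

(** Reduced to a curve through the identity by
    [Ad (sigma s) = Ad (sigma t) Ad ((sigma t)^-1 sigma s)]. *)
Lemma is_derive_Ad (sigma : R -> N) (t : R) X Y :
  {for t, continuous sigma} ->
  is_derive (t : R) (1 : R) (fun s => phi ((sigma t)^-1 * sigma s)%g) X ->
  is_derive (t : R) (1 : R) (fun s => Ad (sigma s) Y) (Ad (sigma t) (lie_bracket phi X Y)).
Proof.
move=> cs ds; pose tau s := ((sigma t)^-1 * sigma s)%g.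
have -> : (fun s => Ad (sigma s) Y) = (fun s => Ad (sigma t) (Ad (tau s) Y)).
  by apply/funext => s; rewrite -AdM /tau mulgA mulgV mul1g.
have d1 : is_derive (t : R) (1 : R) (fun s => Ad (tau s) Y) (lie_bracket phi X Y).
  apply: (is_derive_Ad1 Y _ _ ds); last by rewrite /tau mulVg.
  exact: cvg_mulg (cvg_cst _) cs.
exact: (is_derive_linear (Ad (sigma t)) d1).
Qed.

(** * 2-step nilpotent groups *)

Context (hnil : two_step_nilpotent phi).

Lemma lie_bracket_bracket U V W : lie_bracket phi U (lie_bracket phi V W) = 0.
Proof. by rewrite lie_bracketC hnil oppr0. Qed.

(** In terms of [ad], [Ad x . ad Y = ad Y = ad Y . Ad x]: both hold as soon as
    [Ad x = 1 + ad U] for some [U], because products of two [ad] vanish. *)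
Definition Ad_unipotent (x : N) : Prop :=
  (forall Y Y', Ad x (lie_bracket phi Y Y') = lie_bracket phi Y Y') /\
  (forall Y Y', lie_bracket phi Y (Ad x Y') = lie_bracket phi Y Y').

Lemma Ad_unipotentM x y : Ad_unipotent x -> Ad_unipotent y -> Ad_unipotent (x * y)%g.
Proof.
move=> [x1 x2] [y1 y2]; split=> Y Y'; first by rewrite AdM y1 x1.
by rewrite AdM x2 y2.
Qed.

Lemma Ad_unipotentV x : Ad_unipotent x -> Ad_unipotent (x^-1)%g.
Proof.
move=> [x1 x2]; split=> Y Y'; first by rewrite -{1}x1 AdK.
by rewrite -x2 AdKV.
Qed.

(** Near the identity, [x] is joined to [1] by the segment [z] in the chart.
    Along it the derivative of [Ad [Y, Y']] is [Ad [X, [Y, Y']] = 0]; once the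
    brackets are known to be fixed, that of [[Y, Ad Y']] is [[Y, [X, Y']] = 0]. *)
Lemma near_Ad_unipotent : \forall x \near (1%g : N), Ad_unipotent x.
Proof.
have /nbhs_ballP[r /= r0 br] := near_chart_img hphi1.
suff H : forall y, ball e r y -> Ad_unipotent (psi y).
  have n1 : \forall x \near (1%g : N), ball e r (phi x).
    exact: (chart_map_continuous hphi1) (nbhsx_ballx _ _ r0).
  apply: filterS2 n1 (near_chart_dom hphi1) => x bx dx.
  by rewrite -(chart_mapK dx); exact: H.
pose z y (t : R) := t *: (y - e) + e.
have z1 y : z y 1 = y by rewrite /z scale1r subrK.
have z0 y : z y 0 = e by rewrite /z scale0r add0r.
have zb y t : ball e r y -> 0 <= t <= 1 -> ball e r (z y t).
  rewrite -ball_normE /= => yb /andP[t0 t1].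
  rewrite /z opprD addrCA subrr addr0 normrN normrZ ger0_norm//.
  by rewrite (le_lt_trans _ yb)// distrC ler_piMl.
have dAd y t Y : ball e r y -> 0 <= t <= 1 -> exists X,
    is_derive (t : R) (1 : R) (fun s => Ad (psi (z y s)) Y)
      (Ad (psi (z y t)) (lie_bracket phi X Y)).
  move=> yb t01; have zi := br _ (zb _ _ yb t01); have [zd zE] := chart_imgK zi.
  have dz := is_derive_line e (y - e) t.
  pose f w := phi ((psi (z y t))^-1 * psi w)%g.
  have df : differentiable f (z y t).
    have df0 : differentiable f (phi (psi (z y t))).
      by apply: (differentiable_mulgl hphi hphi zd); rewrite mulVg.
    by rewrite zE in df0.
  exists ('D_(y - e) f (z y t)).
  apply: (@is_derive_Ad (fun s => psi (z y s)) t); last exact: (is_derive_chain dz df).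
  have cz : {for t, continuous (z y)}.
    by apply: differentiable_continuous; apply/derivable1_diffP; case: dz.
  by apply: (continuous_comp cz); exact: chart_inv_continuous.
have H1 y Y Y' : ball e r y -> Ad (psi y) (lie_bracket phi Y Y') = lie_bracket phi Y Y'.
  move=> yb.
  have := @eq_of_is_derive0 R m (fun t => Ad (psi (z y t)) (lie_bracket phi Y Y')).
  rewrite z1 z0 chart_inv_map1 Ad1; apply => t t01.
  have [X] := dAd y t (lie_bracket phi Y Y') yb t01.
  by rewrite lie_bracket_bracket linear0.
move=> y yb; split=> Y Y'; first exact: H1.
pose adY : {linear n -> n} := HB.pack (lie_bracket phi Y)
  (GRing.isLinear.Build _ _ _ _ _ (lie_bracket_linearr Y)).
have := @eq_of_is_derive0 R m (fun t => adY (Ad (psi (z y t)) Y')).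
rewrite z1 z0 chart_inv_map1 Ad1; apply => t t01.
have [X dX] := dAd y t Y' yb t01.
have := is_derive_linear adY dX.
by rewrite (H1 _ _ _ (zb _ _ yb t01)) /= lie_bracket_bracket.
Qed.

Lemma Ad_unipotentT x : @path_connected R N -> Ad_unipotent x.
Proof.
move=> pc; apply: (path_connected_group_ind pc near_Ad_unipotent).
  exact: Ad_unipotentM.
exact: Ad_unipotentV.
Qed.

(** Right translations by [x] are included because the one-parameter group of
    [lambda] has to be followed along [gamma t . sigma 0].  They do not change
    the derivative: [Ad (sigma s . x) = Ad (sigma s) Ad x] has the derivative
    [Ad (sigma t) . ad X . Ad x = ad X]. *)
Lemma exists_left_invariant_primitive (k : {linear n -> R}) :
  @path_connected R N -> (forall Z, lie_center phi Z -> k Z = 0) ->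
  exists h : N -> R, forall (x : N) (sigma : R -> N) (t : R) X,
    {for t, continuous sigma} ->
    is_derive (t : R) (1 : R) (fun s => phi ((sigma t)^-1 * sigma s)%g) X ->
    is_derive (t : R) (1 : R) (fun s => h (sigma s * x)%g) (k X).
Proof.
move=> pc kZ.
pose adm X := \matrix_(i < m) lie_bracket phi X (delta_mx 0 i).
have adP : linear (fun X => mxvec (adm X)).
  exact: (linear_rows (f := fun i X => lie_bracket phi X (delta_mx 0 i))
    (fun i => lie_bracket_linearl (delta_mx 0 i))).
pose ad : {linear n -> 'rV[R]_(m * m)} := HB.pack (fun X => mxvec (adm X))
  (GRing.isLinear.Build _ _ _ _ _ adP).
have [X|l lE] := factor_linear (f := ad) (k := k).
  (* The kernel of [ad] is the center. *)
  move=> adX; apply: kZ => Y; rewrite lie_bracketC.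
  have admX : adm X = 0 by apply: (can_inj mxvecK); rewrite linear0.
  pose adX' : {linear n -> n} := HB.pack (lie_bracket phi X)
    (GRing.isLinear.Build _ _ _ _ _ (lie_bracket_linearr X)).
  have adX0 i : adX' (delta_mx 0 i) = 0.
    have := rowK (fun i => lie_bracket phi X (delta_mx 0 i)) i.
    by rewrite -/(adm X) admX row0.
  rewrite -[lie_bracket phi X Y]/(adX' Y) [Y]row_sum_delta linear_sum big1 ?oppr0// => i _.
  by rewrite linearZ adX0; exact: scaler0.
pose h x := l (mxvec (\matrix_(i < m) Ad x (delta_mx 0 i))).
exists h => x sigma t X cs ds.
pose L : {linear 'M[R]_m -> R} := l \o mxvec.
suff dM : is_derive (t : R) (1 : R)
    (fun s => \matrix_(i < m) Ad (sigma s * x)%g (delta_mx 0 i)) (adm X).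
  by rewrite -lE; exact: (is_derive_linear L dM).
apply/is_derive_mxP => i j; rewrite [adm X i j]mxE.
under eq_fun do rewrite mxE AdM.
have [u1 _] := Ad_unipotentT (sigma t) pc; have [_ u2] := Ad_unipotentT x pc.
have := is_derive_Ad (Ad x (delta_mx 0 i)) cs ds; rewrite u1 u2.
by move=> /is_derive_mxP/(_ 0 j).
Qed.

End LieGroup.

(** * Inner product, connection and velocities *)

Section Metric.
Set Implicit Arguments.
Unset Strict Implicit.
Context {R : realType} {N : groupTopologicalType} {m : nat}.
Context (phi : @chart R N m) (g : {dot 'rV[R]_m for idfun}).
Local Notation n := 'rV[R]_m.

Lemma dotC (u v : n) : g u v = g v u.
Proof. by rewrite hermC expr0 mul1r. Qed.

Lemma dot_linearl (v : n) : linear (fun u => g u v : R).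
Proof. by move=> a x y; rewrite linearPl. Qed.

Lemma dot_eq0 (u : n) : g u u = 0 -> u = 0.
Proof.
move=> gu; apply/eqP; apply: contra_eqT gu => /(neq0_dnorm_gt0 (s := g)).
by rewrite lt0r => /andP[].
Qed.

(** As [Z] is central, [nabla_u Z = nabla_Z u], and [nabla_Z] is skew, whence
    [<nabla_u u, Z> = - <u, nabla_u Z> = - <u, nabla_Z u> = 0]. *)
Lemma levi_civita_self_central (nabla : {bilinear n -> n -> n}) u Z :
  levi_civita phi g nabla -> lie_center phi Z -> g (nabla u u) Z = 0.
Proof.
move=> hn cZ.
have uZ : nabla u Z = nabla Z u.
  by apply/eqP; rewrite -subr_eq0 (levi_civita_torsion_free hn) cZ.
have := levi_civita_metric hn u u Z; rewrite uZ.
have := levi_civita_metric hn Z u u; rewrite [X in X + _]dotC.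
by move: (g u _) (g (nabla u u) Z) => a b; lra.
Qed.

(** The left translation by [lambda] cancels in [(sigma t)^-1 sigma s]. *)
Lemma left_velocity_periodic (lambda : N) (omega : R) (sigma : R -> N) u :
  (forall t, (lambda * sigma t)%g = sigma (t + omega)) ->
  left_velocity phi sigma u -> forall t, u (t + omega) = u t.
Proof.
move=> per vel t.
have [_ <-] := vel t; have [_ <-] := is_derive_translate (vel (t + omega)).
congr ('D_1 _ t); apply/funext => s; rewrite -!per.
by rewrite invgM mulgA -[(_ * lambda)%g]mulgA mulVg mulg1.
Qed.

Lemma left_velocity_exp (gamma : R -> N) X :
  (forall s t, gamma (s + t) = (gamma s * gamma t)%g) ->
  is_derive (0 : R) (1 : R) (fun t : R => phi (gamma t)) X ->
  left_velocity phi gamma (fun=> X).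
Proof.
move=> hom dX t.
have E : (fun s => phi ((gamma t)^-1 * gamma s)%g) = (fun s => phi (gamma (s - t))).
  apply/funext => s; congr (phi _); apply: (mulgI (gamma t)).
  by rewrite mulgA mulgV mul1g -hom addrC subrK.
rewrite E; apply: (is_derive_translate (f := fun s => phi (gamma s))).
by rewrite subrr.
Qed.

End Metric.

(** * Magnetic trajectories *)

Theorem lemma4p5 (R : realType) (m : nat) (N : groupTopologicalType)
    (A : set (@chart R N m)) (hN : lie_group A)
    (hsc : @simply_connected R N)
    (phi : @chart R N m) (hphi : A phi) (hphi1 : chart_dom phi 1%g)
    (hnil : two_step_nilpotent phi)
    (g : {dot 'rV[R]_m for idfun})
    (nabla : {bilinear 'rV[R]_m -> 'rV[R]_m -> 'rV[R]_m})
    (hnabla : levi_civita phi g nabla)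
    (q : R) (hq : q <> 0)
    (lambda : N) (W1 Z1 : 'rV[R]_m)
    (hW1 : lie_center_orth phi g W1) (hZ1 : lie_center phi Z1)
    (hlambda : is_exp phi (W1 + Z1) lambda)
    (F : {linear 'rV[R]_m -> 'rV[R]_m})
    (hF : lorentz_force phi g F) (hII : type_II phi g F)
    (hper : exists sigma : R -> N,
      magnetic_trajectory phi nabla q F sigma /\
      lambda_periodic lambda sigma) :
  F W1 = 0.
Proof.
have [FvZ FzV] := hII.
have [sigma [[csigma [u [a [vel du eq]]]] [_ [omega [_ per]]]]] := hper.
have [gamma [cgamma gammaM dgamma gamma1]] := hlambda.
set Z := F W1; have cZ : lie_center phi Z by exact: FvZ.
set V := F Z; have oV : lie_center_orth phi g V by exact: FzV.
pose k : {linear 'rV[R]_m -> R} := HB.pack (fun X => g X V)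
  (GRing.isLinear.Build _ _ _ _ _ (dot_linearl g V)).
pose kZ : {linear 'rV[R]_m -> R} := HB.pack (fun X => g X Z)
  (GRing.isLinear.Build _ _ _ _ _ (dot_linearl g Z)).
have kc X : lie_center phi X -> k X = 0 by move=> cX; rewrite /= dotC oV.
have [h hP] := exists_left_invariant_primitive hN hphi hphi1 hnil hsc.1 kc.
(* Integration of the 1-form [<_, V>] along [gamma t . sigma 0]. *)
have hlam : h (lambda * sigma 0)%g = h (sigma 0) + g W1 V.
  pose f s := h (gamma s * sigma 0)%g + - g W1 V * s.
  have df (t : R) : is_derive (t : R) (1 : R) f 0.
    have -> : 0 = k (W1 + Z1) + - g W1 V * 1.
      by rewrite linearD (kc Z1)//= addr0 mulr1 subrr.
    have did : is_derive (t : R) (1 : R) (fun s : R => s) 1 by exact: is_derive_id.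
    apply: (is_derive_addr _ (is_derive_mulr (- g W1 V) did)).
    apply: hP; first exact: cgamma.
    exact: (left_velocity_exp gammaM dgamma t).
  have := is_derive_0_is_cst 1 0 df; rewrite /f gamma1.
  have -> : gamma 0 = 1%g.
    by apply: (mulgI (gamma 0)); rewrite -gammaM addr0 mulg1.
  by rewrite mul1g mulr0 addr0 mulr1 => <-; rewrite subrK.
(* The conserved quantity [h (sigma t) + q^-1 <u t, Z>], between two points
   with the same velocity [u]. *)
have hsig : h (sigma omega) = h (sigma 0).
  pose f s := h (sigma s * 1)%g + q^-1 * kZ (u s).
  have df (t : R) : is_derive (t : R) (1 : R) f 0.
    have -> : 0 = k (u t) + q^-1 * kZ (a t).
      have -> : a t = q *: F (u t) - nabla (u t) (u t) by rewrite -eq addrK.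
      rewrite linearB linearZ /= (levi_civita_self_central _ hnabla cZ) subr0.
      by rewrite (lorentz_skew hF) mulKf ?subrr//; exact/eqP.
    apply: (is_derive_addr _ (is_derive_mulr q^-1 (is_derive_linear kZ (du t)))).
    by apply: hP; [exact: csigma|exact: vel].
  have := is_derive_0_is_cst omega 0 df; rewrite /f !mulg1.
  by rewrite -[in u omega](add0r omega) (left_velocity_periodic per vel) => /addIr.
apply: (@dot_eq0 _ _ g); rewrite (lorentz_skew hF).
move: hlam; rewrite per add0r hsig => /eqP.
by rewrite -subr_eq0 opprD addNKr oppr_eq0 => /eqP; rewrite -/Z -/V => ->; rewrite oppr0.
Qed.
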